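(* Consider the following dynamic program. Order the items lexicographically by their index pairs: $e_{ab} \preceq e_{ij}$ iff $a<i$, or $a=i$ and $b\le j$. For every item $e_{ij}$ and every integer $k\in\{0,1,\dots,W\}$ define $\beta(i,j,k)\in\mathbb{R}\cup\{-\infty\}$ as follows (where $\beta(\cdot,\cdot,k)=-\infty$ whenever $k<0$ or $k>W$). For the first item $e_{ij}$ in the order $\preceq$: $\beta(i,j,0)=B(\emptyset)$, $\beta(i,j,w_{ij})=B(\{e_{ij}\})$, and $\beta(i,j,k)=-\infty$ for all other $k$. For every other item $e_{ij}$ with immediate predecessor $e_{i'j'}$ in $\preceq$: $$\beta(i,j,k)=\max\Big\{\beta(i',j',k),\ \ \beta(i',j',k-w_{ij})+p_{ij}-R\,d_{in}\Big(\frac{1}{v_{\max}-\nu k}-\frac{1}{v_{\max}-\nu(k-w_{ij})}\Big)\Big\},$$ where $d_{in}=\sum_{l=i}^{n} d_l$ and $-\infty$ plus a real number is $-\infty$. Then for every item $e_{ij}$ and every $k\in\{0,\dots,W\}$, $\beta(i,j,k)$ equals the maximum of $B(S)$ over all subsets $S\subseteq I_{ij}=\{e_{ab}\mid e_{ab}\preceq e_{ij}\}$ whose total weight is exactly $k$ (and equals $-\infty$ if no such subset exists).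
   Context: Packing While Traveling (PWT): there are $n+1$ cities on a fixed route $1,2,\dots,n+1$, with positive distances $d_i$ from city $i$ to city $i+1$ ($1\le i\le n$). City $i$ ($1\le i\le n$) holds a finite set $M_i$ of items $e_{i1},\dots,e_{im_i}$; item $e_{ij}$ has positive integer profit $p_{ij}$ and positive integer weight $w_{ij}$. A vehicle travels the route with maximal speed $v_{\max}$ and minimal speed $v_{\min}$, $0<v_{\min}<v_{\max}$, and has capacity $W$ (a positive integer); set $\nu=(v_{\max}-v_{\min})/W$. A renting rate $R>0$ is given. A subset $S$ of items is encoded by $x_{ij}\in\{0,1\}$ ($x_{ij}=1$ iff $e_{ij}\in S$). Its benefit is $B(S)=P(S)-R\,T(S)$ with $P(S)=\sum_{i,j}p_{ij}x_{ij}$ and $T(S)=\sum_{i=1}^n \frac{d_i}{v_{\max}-\nu\sum_{k=1}^{i}\sum_{j=1}^{m_k}w_{kj}x_{kj}}$. $B(\emptyset)=-R\sum_{i=1}^n d_i/v_{\max}$ and $B(\{e_{ij}\})$ is the benefit when only item $e_{ij}$ is selected. *)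

(* Defs.v *)
From HB Require Import structures.
From mathcomp Require Import all_boot all_order all_algebra.
From mathcomp Require Import reals constructive_ereal.

Set Implicit Arguments.
Unset Strict Implicit.
Unset Printing Implicit Defensive.

Import Order.TTheory GRing.Theory Num.Theory.
Local Open Scope ring_scope.

(* Indices are 0-based: [i : 'I_ncity] is the (i+1)-st city of the route (the
   final city, which holds no items, has no index), and [dist i] is the
   distance from it to the next city. *)
Record pwt (R : realType) := Pwt {
  ncity : nat;
  nitem : 'I_ncity -> nat;
  dist : 'I_ncity -> R;
  profit : forall i, 'I_(nitem i) -> nat;
  weight : forall i, 'I_(nitem i) -> nat;
  vmax : R;
  vmin : R;
  capacity : nat;
  rent : R;
  dist_gt0 : forall i, 0 < dist i;
  profit_gt0 : forall i (j : 'I_(nitem i)), (0 < profit j)%N;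
  weight_gt0 : forall i (j : 'I_(nitem i)), (0 < weight j)%N;
  vmin_gt0 : 0 < vmin;
  vmin_lt_vmax : vmin < vmax;
  capacity_gt0 : (0 < capacity)%N;
  rent_gt0 : 0 < rent
}.

Arguments dist {R} p i.
Arguments profit {R} p i j.
Arguments weight {R} p i j.

Section Definitions.
Variables (R : realType) (I : pwt R).

(* The item e_ij is the dependent pair of i and j. *)
Definition item : finType := {i : 'I_(ncity I) & 'I_(nitem i)}.

Definition mkitem (i : 'I_(ncity I)) (j : 'I_(nitem i)) : item :=
  Tagged (fun i => 'I_(nitem i)) j.

Definition item_profit (e : item) : nat := profit I (tag e) (tagged e).
Definition item_weight (e : item) : nat := weight I (tag e) (tagged e).

Definition selected (S : {set item}) i (j : 'I_(nitem i)) : nat :=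
  mkitem j \in S.

Definition nu : R := (vmax I - vmin I) / (capacity I)%:R.

Definition total_profit (S : {set item}) : nat :=
  (\sum_(i < ncity I) \sum_(j < nitem i) profit I i j * selected S j)%N.

Definition total_weight (S : {set item}) : nat :=
  (\sum_(i < ncity I) \sum_(j < nitem i) weight I i j * selected S j)%N.

Definition load (S : {set item}) (i : 'I_(ncity I)) : nat :=
  (\sum_(k < ncity I | k <= i)
     \sum_(j < nitem k) weight I k j * selected S j)%N.

Definition travel_time (S : {set item}) : R :=
  \sum_(i < ncity I) dist I i / (vmax I - nu * (load S i)%:R).

Definition benefit (S : {set item}) : R :=
  (total_profit S)%:R - rent I * travel_time S.

Definition item_le (e f : item) : bool :=
  ((tag e < tag f) || ((tag e == tag f) && (tagged e <= tagged f)))%N.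

Definition item_lt (e f : item) : bool := (e != f) && item_le e f.

Definition first_item (e : item) : bool := [forall f, item_le e f].

Definition immediate_pred (e' e : item) : bool :=
  item_lt e' e && ~~ [exists f, item_lt e' f && item_lt f e].

Definition dist_to_end (i : 'I_(ncity I)) : R :=
  \sum_(l < ncity I | (i <= l)%N) dist I l.

Definition speed_at (k : int) : R := vmax I - nu * k%:~R.

(* The defining equations of the dynamic program; the third argument ranges
   over all integers so that k - w_ij is a genuine subtraction. *)
Definition dp_table (beta : item -> int -> \bar R) : Prop :=
  [/\ forall e (k : int), (k < 0) || ((capacity I)%:Z < k) -> beta e k = -oo%E,
      forall e (k : int), first_item e -> 0 <= k <= (capacity I)%:Z ->
        beta e k = if k == 0 then (benefit set0)%:E
                   else if k == (item_weight e)%:Z then (benefit [set e])%:E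
                   else -oo%E
    & forall e' e (k : int), immediate_pred e' e -> 0 <= k <= (capacity I)%:Z ->
        let w := (item_weight e)%:Z in
        beta e k =
          maxe (beta e' k)
               (beta e' (k - w)%R
                + ((item_profit e)%:R
                   - rent I * dist_to_end (tag e)
                     * (1 / speed_at k - 1 / speed_at (k - w)))%:E)%E].

(* The equations are satisfiable; [dp_fuel N e] is the intended table as soon
   as N exceeds the number of items preceding e. *)
Fixpoint dp_fuel (N : nat) (e : item) (k : int) : \bar R :=
  if N is N'.+1 then
    if (k < 0) || ((capacity I)%:Z < k) then -oo%E
    else if first_item e then
      if k == 0 then (benefit set0)%:E
      else if k == (item_weight e)%:Z then (benefit [set e])%:E
      else -oo%E
    else if [pick e' | immediate_pred e' e] is Some e' then
      let w := (item_weight e)%:Z in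
      maxe (dp_fuel N' e' k)
           (dp_fuel N' e' (k - w)%R
            + ((item_profit e)%:R
               - rent I * dist_to_end (tag e)
                 * (1 / speed_at k - 1 / speed_at (k - w)))%:E)%E
    else -oo%E
  else -oo%E.

Let rank (e : item) : nat := #|[set f | item_lt f e]|.

Lemma item_le_total e f : item_le e f || item_le f e.
Proof.
rewrite /item_le; case: ltngtP => //= ef; rewrite ?orbT //.
by rewrite -!val_eqE /= ef eqxx leq_total.
Qed.

Lemma item_le_anti e f : item_le e f -> item_le f e -> e = f.
Proof.
case: e f => [i j] [i' j']; rewrite /item_le /= -!val_eqE /=.
case: ltngtP => //= /val_inj ii'; case: _ / ii' j' => j' l1 l2.
by congr Tagged; apply/val_inj/eqP; rewrite eqn_leq l1.
Qed.

Lemma item_le_trans f e g : item_le e f -> item_le f g -> item_le e g.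
Proof.
rewrite /item_le -!val_eqE /=.
case: (ltngtP (tag e) (tag f)) => //= [ef|ef].
  by case: (ltngtP (tag f) (tag g)) => //= [fg|fg] _ _;
     rewrite ?(ltn_trans ef fg) // -fg ef.
rewrite ef; case: (ltngtP (tag f) (tag g)) => //= _; exact: leq_trans.
Qed.

Lemma item_lt_le_trans f e g : item_lt e f -> item_le f g -> item_lt e g.
Proof.
move=> /andP[nef ef] fg; rewrite /item_lt (item_le_trans ef fg) andbT.
by apply: contra nef => /eqP eg; rewrite -eg in fg; rewrite (item_le_anti ef fg).
Qed.

Lemma immediate_pred_inj e1 e2 e :
  immediate_pred e1 e -> immediate_pred e2 e -> e1 = e2.
Proof.
move=> /andP[l1 /existsPn n1] /andP[l2 /existsPn n2].
apply/eqP; apply: contraT => ne; case/orP: (item_le_total e1 e2) => le12.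
  by have := n1 e2; rewrite /item_lt ne le12 /=; move: l2; rewrite /item_lt => ->.
by have := n2 e1; rewrite /item_lt eq_sym ne le12 /=;
   move: l1; rewrite /item_lt => ->.
Qed.

Lemma immediate_pred_first e' e : immediate_pred e' e -> first_item e = false.
Proof.
move=> /andP[/andP[ne le] _]; apply/negP => /forallP/(_ e') le'.
by rewrite (item_le_anti le le') eqxx in ne.
Qed.

Lemma rank_immediate_pred e' e : immediate_pred e' e -> (rank e' < rank e)%N.
Proof.
move=> /andP[lt _]; apply/proper_card/properP; split.
  apply/subsetP => f; rewrite !inE => fe'.
  by apply: item_lt_le_trans fe' _; case/andP: lt.
by exists e'; rewrite !inE // /item_lt eqxx.
Qed.

Lemma dp_fuel_indep N N' e k :
  (rank e < N)%N -> (rank e < N')%N -> dp_fuel N e k = dp_fuel N' e k.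
Proof.
elim: N N' e k => [//|N IH] [//|N'] e k rN rN' /=.
case: ifP => // _; case: ifP => // _; case: pickP => // e' ip.
have r := rank_immediate_pred ip.
by rewrite !(IH N' e') // (leq_trans r).
Qed.

Lemma dp_table_exists : exists beta, dp_table beta.
Proof.
pose beta e k := dp_fuel (rank e).+1 e k.
exists beta; split=> [e k kN|e k fe|e' e k ip] /=.
- by rewrite /beta /= kN.
- by move=> /andP[k0 kW]; rewrite /beta /= !ltNge k0 kW fe.
move=> /andP[k0 kW]; rewrite {1}/beta /= !ltNge k0 kW /=.
rewrite (immediate_pred_first ip); case: pickP => [e2 ip2|/(_ e')]; last first.
  by rewrite ip.
rewrite (immediate_pred_inj ip2 ip) /beta.
have r := rank_immediate_pred ip.
by rewrite !(@dp_fuel_indep (rank e) (rank e').+1 e').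
Qed.

End Definitions.

(* Main.v *)
Require Import Defs.
From HB Require Import structures.
From mathcomp Require Import all_boot all_order all_algebra.
From mathcomp Require Import reals constructive_ereal.
From mathcomp Require Import ring.

Set Implicit Arguments.
Unset Strict Implicit.
Unset Printing Implicit Defensive.

Import Order.TTheory GRing.Theory Num.Theory.
Local Open Scope ring_scope.

(** Adding an item [e] to a set [S] of items that do not lie beyond the city of
    [e] changes the load only on the roads from that city onwards, and there the
    load of [S] is already its total weight. So the change of benefit depends on
    [S] through its weight alone, and splitting the sets of a given weight
    according to whether they contain [e] yields the recurrence. *)

Definition predecessor d (T : porderType d) (x y : T) : Prop :=
  forall z, (z <= x)%O = (z < y)%O.

Lemma predecessor_ind d (T : finOrderType d) (P : T -> Prop) :
    (forall y, (forall x, y <= x)%O -> P y) ->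
    (forall x y, predecessor x y -> P x -> P y) ->
  forall y, P y.
Proof.
move=> P_min P_pred y; have [n] := ubnP #|[set z | (z < y)%O]|.
elim: n y => // n IHn y /ltnSE card_le_y.
have [x0 x0_lt_y|y_min] := pickP (fun x => x < y)%O; last first.
  by apply: P_min => x; rewrite leNgt y_min.
case: (@arg_maxP _ _ _ _ (fun x => x < y)%O id x0_lt_y) => x x_lt_y x_max.
apply: (P_pred x) => [z|].
  by apply/idP/idP => [/le_lt_trans->//|/x_max].
apply: IHn; apply: leq_trans card_le_y; apply/proper_card/properP; split.
  by apply/subsetP => z; rewrite !inE => /lt_trans; apply.
by exists x; rewrite !inE // ltxx.
Qed.

Lemma big_subsetU1 (R : Type) (idx : R) (op : Monoid.com_law idx)
    (T : finType) (a : T) (D : {set T}) (P : pred {set T}) (F : {set T} -> R) :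
    a \notin D ->
  \big[op/idx]_(S : {set T} | (S \subset a |: D) && P S) F S =
    op (\big[op/idx]_(S : {set T} | (S \subset D) && P S) F S)
       (\big[op/idx]_(S : {set T} | (S \subset D) && P (a |: S)) F (a |: S)).
Proof.
move=> aD; rewrite (bigID (fun S : {set T} => a \in S)) /= Monoid.mulmC.
congr (op _ _).
  apply: eq_bigl => S; rewrite andbAC; congr (_ && _).
  by rewrite -subsetD1 setU1K.
rewrite (reindex_onto (fun S => a |: S) (fun S => S :\ a)) /=; last first.
  by move=> S /andP[_]; apply: setD1K.
apply: eq_bigl => S; rewrite setU11 andbT andbAC; congr (_ && _).
apply/andP/idP => [[sub /eqP <-]|sub]; first by rewrite subDset.
by rewrite setUS // setU1K // (contra (subsetP sub a)).
Qed.

Lemma adde_bigmaxl (R : realDomainType) (J : Type) (r : seq J) (P : pred J)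
    (F : J -> \bar R) (x : \bar R) :
  (\big[maxe/-oo]_(j <- r | P j) F j + x =
   \big[maxe/-oo]_(j <- r | P j) (F j + x))%E.
Proof.
by apply: (big_morph (fun y => y + x)%E) => [y z|]; rewrite ?adde_maxl ?addNye.
Qed.

Section PackingWhileTraveling.
Variables (R : realType) (I : pwt R).
Implicit Types (e f : item I) (S D : {set item I}).

Lemma item_leE e f : item_le e f = (e <= f)%O.
Proof.
case: e f => [i j] [i' j']; rewrite /item_le leEsig /= !leEord -val_eqE /=.
case: ltngtP => //= /val_inj ii'; case: _ / ii' j' => j'.
by rewrite tagged_asE.
Qed.

Lemma item_ltE e f : item_lt e f = (e < f)%O.
Proof. by rewrite /item_lt item_leE lt_neqAle. Qed.

Lemma tag_le e f : (e <= f)%O -> (tag e <= tag f)%N.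
Proof. by rewrite leEsig => /andP[]. Qed.

Lemma first_itemP e : reflect (forall f, e <= f)%O (first_item e).
Proof.
by apply: (iffP forallP) => e_min f; move: (e_min f); rewrite item_leE.
Qed.

Lemma immediate_predP e' e :
  reflect (predecessor e' e) (immediate_pred e' e).
Proof.
rewrite /immediate_pred item_ltE.
apply: (iffP andP) => [[lt_e'e no_between] f|leE].
  apply/idP/idP => [/le_lt_trans->//|lt_fe]; rewrite leNgt.
  apply: contra no_between => lt_e'f; apply/existsP; exists f.
  by rewrite !item_ltE lt_e'f.
split; first by rewrite -leE.
by apply/existsPn => f; rewrite !item_ltE -leE leNgt andbN.
Qed.

Definition items_upto e : {set item I} := [set f | item_le f e].

Lemma items_upto_first e : (forall f, e <= f)%O -> items_upto e = [set e].
Proof.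
by move=> e_min; apply/setP => f; rewrite !inE item_leE eq_le e_min andbT.
Qed.

Lemma items_upto_pred e' e : predecessor e' e ->
  items_upto e = e |: items_upto e'.
Proof.
by move=> leE; apply/setP => f; rewrite !inE !item_leE leE le_eqVlt.
Qed.

Lemma sum_selected (P : pred 'I_(ncity I)) (F : item I -> nat) S :
  (\sum_(i < ncity I | P i) \sum_(j < nitem i) F (mkitem j) * selected S j =
   \sum_(f in S | P (tag f)) F f)%N.
Proof.
rewrite (@sig_big_dep _ _ _ _ _ P (fun=> predT)
  (fun i j => F (mkitem j) * selected S j)%N) /=.
rewrite big_mkcond [RHS]big_mkcond /=; apply: eq_bigr => -[i j] _ /=.
by rewrite andbT /selected; case: (P i); case: (_ \in S); rewrite ?muln1 ?muln0.
Qed.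

Lemma total_profitE S : total_profit S = (\sum_(f in S) item_profit f)%N.
Proof.
rewrite [LHS](sum_selected predT (@item_profit _ I)).
by apply: eq_bigl => f; rewrite andbT.
Qed.

Lemma total_weightE S : total_weight S = (\sum_(f in S) item_weight f)%N.
Proof.
rewrite [LHS](sum_selected predT (@item_weight _ I)).
by apply: eq_bigl => f; rewrite andbT.
Qed.

Lemma loadE S i : load S i = (\sum_(f in S | (tag f <= i)%N) item_weight f)%N.
Proof.
exact: (sum_selected (fun k : 'I_(ncity I) => k <= i)%N (@item_weight _ I)).
Qed.

Lemma travel_timeE S :
  travel_time S = \sum_(i < ncity I) dist I i / speed_at I (load S i)%:Z.
Proof. by []. Qed.

Lemma total_profitU1 S e : e \notin S ->
  total_profit (e |: S) = (item_profit e + total_profit S)%N.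
Proof. by move=> eS; rewrite !total_profitE big_setU1. Qed.

Lemma total_weightU1 S e : e \notin S ->
  total_weight (e |: S) = (item_weight e + total_weight S)%N.
Proof. by move=> eS; rewrite !total_weightE big_setU1. Qed.

Lemma total_weight0 : total_weight (set0 : {set item I}) = 0%N.
Proof. by rewrite total_weightE big_set0. Qed.

Lemma loadU1_before S e (i : 'I_(ncity I)) :
  (i < tag e)%N -> load (e |: S) i = load S i.
Proof.
move=> i_lt_e; rewrite !loadE; apply: eq_bigl => f; rewrite !inE.
by case: eqP => // ->; rewrite leqNgt i_lt_e !andbF.
Qed.

Lemma load_total_weight S (i : 'I_(ncity I)) :
  {in S, forall f, tag f <= i}%N -> load S i = total_weight S.
Proof.
move=> S_le_i; rewrite loadE total_weightE; apply: eq_bigl => f.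
by apply: andb_idr => /S_le_i.
Qed.

Lemma travel_timeU1 S e : {in S, forall f, tag f <= tag e}%N ->
  travel_time (e |: S) - travel_time S =
    dist_to_end (tag e) *
      (1 / speed_at I (total_weight (e |: S))%:Z
       - 1 / speed_at I (total_weight S)%:Z).
Proof.
move=> S_le_e; rewrite !travel_timeE -sumrB.
rewrite /dist_to_end mulr_suml [RHS]big_mkcond.
apply: eq_bigr => i _; case: leqP => [e_le_i|i_lt_e]; last first.
  by rewrite loadU1_before // subrr.
have S_le_i : {in S, forall f, tag f <= i}%N.
  by move=> f /S_le_e f_le_e; apply: leq_trans e_le_i.
by rewrite !load_total_weight; [ring | | move=> f /setU1P[->|/S_le_i]].
Qed.

(* [k] is the total weight after [e] has been added. *)
Definition marginal_benefit e (k : int) : R :=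
  (item_profit e)%:R - rent I * dist_to_end (tag e)
    * (1 / speed_at I k - 1 / speed_at I (k - (item_weight e)%:Z)).

Lemma benefitU1 S e : e \notin S -> {in S, forall f, tag f <= tag e}%N ->
  benefit (e |: S) = benefit S + marginal_benefit e (total_weight (e |: S))%:Z.
Proof.
move=> eS /travel_timeU1 time_e; rewrite /marginal_benefit.
have -> : (total_weight (e |: S))%:Z - (item_weight e)%:Z = (total_weight S)%:Z.
  by rewrite total_weightU1 // PoszD addrAC subrr add0r.
by rewrite -mulrA -time_e /benefit total_profitU1 // natrD; ring.
Qed.

Definition max_benefit D (k : int) : \bar R :=
  \big[maxe/-oo%E]_(S : {set item I} |
      (S \subset D) && ((total_weight S)%:Z == k))
    (benefit S)%:E.

Lemma max_benefit_lt0 D k : k < 0 -> max_benefit D k = -oo%E.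
Proof.
move=> k_lt0; apply: big_pred0 => S; apply/negbTE/nandP; right.
by rewrite gt_eqF // (lt_le_trans k_lt0).
Qed.

Lemma max_benefit0 k : max_benefit set0 k =
  if k == 0 then (benefit (set0 : {set item I}))%:E else -oo%E.
Proof.
rewrite /max_benefit big_mkcondr (big_pred1 set0) => [|S]; last exact: subset0.
by rewrite total_weight0 eq_sym.
Qed.

Lemma max_benefitU1 D e k : e \notin D -> {in D, forall f, tag f <= tag e}%N ->
  max_benefit (e |: D) k =
    maxe (max_benefit D k)
      (max_benefit D (k - (item_weight e)%:Z) + (marginal_benefit e k)%:E)%E.
Proof.
move=> eD D_le_e; rewrite /max_benefit big_subsetU1 // adde_bigmaxl.
have eS S : S \subset D -> e \notin S.
  by move=> /subsetP SD; apply: contra eD => /SD.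
congr maxe; apply: eq_big => [S|S /andP[SD /eqP <-]].
  apply: andb_id2l => SD.
  by rewrite total_weightU1 ?eS // PoszD addrC eq_sym -subr_eq eq_sym.
by rewrite benefitU1 ?eS // => f /(subsetP SD) /D_le_e.
Qed.

Lemma max_benefit1 e k : max_benefit [set e] k =
  if k == 0 then (benefit (set0 : {set item I}))%:E
  else if k == (item_weight e)%:Z then (benefit [set e])%:E
  else -oo%E.
Proof.
rewrite -(setU0 [set e]) max_benefitU1 ?inE //; last by move=> f; rewrite inE.
rewrite !max_benefit0 subr_eq0; have [->|k_neq0] := eqVneq k 0.
  have /gtn_eqF w_neq0 : (0 < item_weight e)%N by exact: weight_gt0.
  by rewrite eqz_nat eq_sym w_neq0 addNye maxeNy.
rewrite maxNye; case: eqP => [->|_]; last by rewrite addNye.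
rewrite benefitU1 ?inE // => [|f]; last by rewrite inE.
by rewrite total_weightU1 ?inE // total_weight0 addn0.
Qed.

End PackingWhileTraveling.

Theorem theorem1 (R : realType) (I : pwt R) (beta : item I -> int -> \bar R)
    (beta_dp : dp_table beta) (e : item I) (k : nat)
    (k_le : (k <= capacity I)%N) :
  beta e k%:Z =
    \big[maxe/-oo%E]_(S : {set item I} |
        (S \subset [set f | item_le f e]) && (total_weight S == k))
      (benefit S)%:E.
Proof.
case: beta_dp => beta_out beta_first beta_pred.
suff betaE (l : int) :
    l <= (capacity I)%:Z -> beta e l = max_benefit (items_upto e) l.
  exact: betaE.
have beta_lt0 f (m : int) : m < 0 -> beta f m = max_benefit (items_upto f) m.
  by move=> m_lt0; rewrite beta_out ?m_lt0 // max_benefit_lt0.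
elim/predecessor_ind: e l => [e e_min|e' e e'_pred IH] l l_le.
- have [/beta_lt0//|l_ge0] := ltP l 0.
  rewrite beta_first ?l_ge0 //; last exact/first_itemP.
  by rewrite items_upto_first // max_benefit1.
- have [/beta_lt0//|l_ge0] := ltP l 0.
  rewrite (beta_pred e') ?l_ge0 //; last exact/immediate_predP.
  rewrite (items_upto_pred e'_pred) max_benefitU1 ?IH //.
  + by rewrite (le_trans _ l_le) // gerBl.
  + by rewrite inE item_leE e'_pred ltxx.
  + by move=> f; rewrite inE item_leE e'_pred => /ltW /tag_le.
Qed.
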